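(* Suppose that $\mu$ is a singular cardinal, $\theta = \mathrm{cf}(\mu)$, and there is a regular cardinal $\kappa \in [\theta^{++}, \mu)$ such that ${\sf cNSP}(\mathscr{P}_\kappa \mu^+)$ holds. Then $\mathsf{CP}(\mathcal D)$ holds for every uniform, transitive $\theta$-covering matrix $\mathcal D$ for $\mu^+$.
   Context: For a regular uncountable cardinal $\kappa$ and a cardinal $\lambda \geq \kappa$, $\mathscr{P}_\kappa \lambda = \{x \subseteq \lambda \mid |x| < \kappa\}$. A concrete $\mathscr{P}_\kappa \lambda$-system is a structure $\mathcal S = \langle S_x \mid x \in A \rangle$ such that (1) $A$ is a $\subseteq$-cofinal subset of $\mathscr{P}_\kappa \lambda$; (2) for all $x \in A$, $\emptyset \neq S_x \subseteq \mathscr{P}(x)$; (3) for all $x \subseteq y$ both in $A$, there is $t \in S_y$ with $t \cap x \in S_x$. Its width is $\sup\{|S_x| \mid x \in A\}$, and it is narrow if $\mathrm{width}(\mathcal S)^+ < \kappa$. A cofinal branch through $\mathcal S$ is a set $b \subseteq \lambda$ such that $\{x \in A \mid b \cap x \in S_x\}$ is $\subseteq$-cofinal in $\mathscr{P}_\kappa \lambda$. ${\sf cNSP}(\mathscr{P}_\kappa\lambda)$ asserts that every narrow concrete $\mathscr{P}_\kappa \lambda$-system has a cofinal branch. For regular cardinals $\theta < \lambda$, a $\theta$-covering matrix for $\lambda$ is $\mathcal D = \langle D(i,\beta) \mid i < \theta, \beta < \lambda\rangle$ such that (1) for each $\beta<\lambda$, $\langle D(i,\beta) \mid i < \theta\rangle$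 is $\subseteq$-increasing with union $\beta$; (2) for all $\beta < \gamma < \lambda$ and $i < \theta$ there is $j < \theta$ with $D(i,\beta) \subseteq D(j,\gamma)$. $\mathcal D$ is transitive if for all $\beta < \gamma<\lambda$ and $i<\theta$, $\beta \in D(i,\gamma)$ implies $D(i,\beta) \subseteq D(i,\gamma)$; uniform if for every limit $\beta < \lambda$ there is $i<\theta$ such that $D(i,\beta)$ contains a club in $\beta$. $\mathsf{CP}(\mathcal D)$ holds if there is an unbounded $A \subseteq \lambda$ such that for every $X \in [A]^\theta$ there are $\beta<\lambda$ and $i<\theta$ with $X \subseteq D(i,\beta)$. *)

(* Defs.v *)
From mathcomp Require Import all_boot all_order.
From mathcomp Require Import all_classical.

Set Implicit Arguments.
Unset Strict Implicit.
Unset Printing Implicit Defensive.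

Local Open Scope classical_set_scope.
Local Open Scope card_scope.

(* Ordinals are the elements of an arbitrary well-ordered type [O], to be thought
   of as an initial segment of the class of ordinals.  An ordinal [a] stands for
   the set [seg a] of its predecessors, and a cardinal is an initial ordinal.
   Well-foundedness of [<] on [O] is a hypothesis of the theorem. *)

Definition well_ordered {d : Order.disp_t} (O : orderType d) : Prop :=
  well_founded (fun a b : O => (a < b)%O).

Definition seg {d : Order.disp_t} {O : orderType d} (a : O) : set O :=
  [set b | (b < a)%O].

Definition card_lt {T U : Type} (X : set T) (Y : set U) : Prop :=
  (X #<= Y) /\ ~ (Y #<= X).

Definition is_cardinal {d : Order.disp_t} {O : orderType d} (k : O) : Prop :=
  forall a : O, (a < k)%O -> ~ (seg a #= seg k).

Definition is_succ_cardinal {d : Order.disp_t} {O : orderType d} (k k' : O) : Prop :=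
  [/\ is_cardinal k', (k < k')%O
    & forall c : O, is_cardinal c -> (k < c)%O -> (k' <= c)%O].

Definition unbounded_in {d : Order.disp_t} {O : orderType d} (a : O) (X : set O) : Prop :=
  X `<=` seg a /\ forall b : O, (b < a)%O -> exists2 c, X c & (b <= c)%O.

Definition cofinal_map {d : Order.disp_t} {O : orderType d} (t a : O) (f : O -> O) : Prop :=
  unbounded_in a (f @` seg t).

(* [t = cf(a)] *)
Definition is_cofinality {d : Order.disp_t} {O : orderType d} (a t : O) : Prop :=
  (exists f, cofinal_map t a f) /\
  forall t' : O, (exists f, cofinal_map t' a f) -> (t <= t')%O.

Definition infinite_cardinal {d : Order.disp_t} {O : orderType d} (k : O) : Prop :=
  is_cardinal k /\ infinite_set (seg k).

Definition regular_cardinal {d : Order.disp_t} {O : orderType d} (k : O) : Prop :=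
  infinite_cardinal k /\ is_cofinality k k.

Definition singular_cardinal {d : Order.disp_t} {O : orderType d} (k : O) : Prop :=
  infinite_cardinal k /\ ~ is_cofinality k k.

Definition is_limit {d : Order.disp_t} {O : orderType d} (a : O) : Prop :=
  (exists b : O, (b < a)%O) /\
  forall b : O, (b < a)%O -> exists2 c : O, (b < c)%O & (c < a)%O.

Definition is_club {d : Order.disp_t} {O : orderType d} (a : O) (C : set O) : Prop :=
  unbounded_in a C /\
  forall g : O, (g < a)%O -> is_limit g -> unbounded_in g (C `&` seg g) -> C g.

Definition Pkl {d : Order.disp_t} {O : orderType d} (kappa lambda : O) : set (set O) :=
  [set x | x `<=` seg lambda /\ card_lt x (seg kappa)].

Definition cofinal_in_Pkl {d : Order.disp_t} {O : orderType d}
    (kappa lambda : O) (A : set (set O)) : Prop :=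
  A `<=` Pkl kappa lambda /\
  forall x, Pkl kappa lambda x -> exists2 y, A y & x `<=` y.

(* The system is [<S x | x in A>]; values of [S] outside [A] are irrelevant. *)
Definition concrete_system {d : Order.disp_t} {O : orderType d}
    (kappa lambda : O) (A : set (set O)) (S : set O -> set (set O)) : Prop :=
  [/\ cofinal_in_Pkl kappa lambda A,
      forall x, A x -> S x !=set0 /\ (forall t, S x t -> t `<=` x)
    & forall x y, A x -> A y -> x `<=` y -> exists2 t, S y t & S x (t `&` x)].

(* [w] is the supremum of the cardinalities of the [S x], [x] in [A]. *)
Definition is_width {d : Order.disp_t} {O : orderType d}
    (A : set (set O)) (S : set O -> set (set O)) (w : O) : Prop :=
  [/\ is_cardinal w,
      forall x, A x -> S x #<= seg w
    & forall w' : O, is_cardinal w' -> (forall x, A x -> S x #<= seg w') -> (w <= w')%O].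

Definition narrow_system {d : Order.disp_t} {O : orderType d}
    (kappa : O) (A : set (set O)) (S : set O -> set (set O)) : Prop :=
  exists w w' : O, [/\ is_width A S w, is_succ_cardinal w w' & (w' < kappa)%O].

Definition cofinal_branch {d : Order.disp_t} {O : orderType d}
    (kappa lambda : O) (A : set (set O)) (S : set O -> set (set O)) (b : set O) : Prop :=
  b `<=` seg lambda /\
  cofinal_in_Pkl kappa lambda [set x | A x /\ S x (b `&` x)].

Definition cNSP {d : Order.disp_t} {O : orderType d} (kappa lambda : O) : Prop :=
  forall (A : set (set O)) (S : set O -> set (set O)),
    concrete_system kappa lambda A S -> narrow_system kappa A S ->
    exists b, cofinal_branch kappa lambda A S b.

(* Only the values [D i beta] for [i < theta] and [beta < lambda] matter. *)
Definition covering_matrix {d : Order.disp_t} {O : orderType d}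
    (theta lambda : O) (D : O -> O -> set O) : Prop :=
  [/\ forall beta : O, (beta < lambda)%O ->
        forall i j : O, (i <= j)%O -> (j < theta)%O -> D i beta `<=` D j beta,
      forall beta : O, (beta < lambda)%O ->
        \bigcup_(i in seg theta) D i beta = seg beta
    & forall beta gamma i : O, (beta < gamma)%O -> (gamma < lambda)%O -> (i < theta)%O ->
        exists2 j : O, (j < theta)%O & D i beta `<=` D j gamma].

Definition transitive_matrix {d : Order.disp_t} {O : orderType d}
    (theta lambda : O) (D : O -> O -> set O) : Prop :=
  forall beta gamma i : O, (beta < gamma)%O -> (gamma < lambda)%O -> (i < theta)%O ->
    D i gamma beta -> D i beta `<=` D i gamma.

Definition uniform_matrix {d : Order.disp_t} {O : orderType d}
    (theta lambda : O) (D : O -> O -> set O) : Prop :=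
  forall beta : O, is_limit beta -> (beta < lambda)%O ->
    exists2 i : O, (i < theta)%O & exists2 C, is_club beta C & C `<=` D i beta.

Definition CP {d : Order.disp_t} {O : orderType d}
    (theta lambda : O) (D : O -> O -> set O) : Prop :=
  exists2 A : set O, unbounded_in lambda A &
    forall X : set O, X `<=` A -> X #= seg theta ->
      exists beta i : O, [/\ (beta < lambda)%O, (i < theta)%O & X `<=` D i beta].

(* Main.v *)
Require Import Defs.
From mathcomp Require Import all_boot all_order.
From mathcomp Require Import all_classical.

Set Implicit Arguments.
Unset Strict Implicit.
Unset Printing Implicit Defensive.

Import Order.TTheory.

Local Open Scope classical_set_scope.
Local Open Scope card_scope.

(* A concrete system is obtained by fixing for each [x] an ordinal [g x] and
   setting [S x = {D i (g x) & x : i < theta}]; taking only [x] with a maximum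
   that belongs to the chosen traces, a cofinal branch is unbounded in [mu^+] and
   witnesses CP.  Coherence of the system requires the traces
   [<D i b & x : i < theta>] to be, modulo an initial segment of [theta],
   independent of [b >= g x].  They increase with [b] by transitivity.  If they
   did not stabilise, one would choose a continuous sequence of length
   [kappa^{++}] along which they change, and a club-guessing sequence on the
   ordinals of cofinality [kappa] below [kappa^{++}], together with uniformity,
   would produce [kappa] many terms of it each of which belongs to [D k] of all
   later ones, for one [k].  Along such terms the traces on [x] are
   inclusion-increasing, so they stabilise because [|x| < kappa]. *)

(** * Cardinalities *)

(** [F] receives the graph of [f] below [a] as a plain set of pairs, so that extensionality of sets
    settles the side condition of [Fix_eq]. *)
Lemma wf_recursion {T U : Type} (R : T -> T -> Prop) (F : T -> set (T * U) -> U) :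
  well_founded R ->
  exists f : T -> U, forall a, f a = F a [set p | R p.1 a /\ p.2 = f p.1].
Proof.
move=> wfR.
pose G a (rec : forall b, R b a -> U) := F a [set p | exists h : R p.1 a, p.2 = rec p.1 h].
exists (Fix wfR (fun _ => U) G) => a.
rewrite Fix_eq => [|b f g fg]; last first.
  by congr (F b _); apply/seteqP; split=> p [h e]; exists h; rewrite e fg.
by congr (F a _); apply/seteqP; split=> p [h e]; [split|exists h].
Qed.

Lemma card_le_surj {T U : Type} (A : set T) (B : set U) (g : U -> T) :
  A `<=` g @` B -> A #<= B.
Proof. by move=> /subset_card_le /card_le_trans; apply; exact: card_image_le. Qed.

Lemma card_le_ex_surj {T U : Type} (A : set T) (B : set U) :
  A !=set0 -> A #<= B -> exists g : U -> T, g @` B = A.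
Proof.
move=> A0 /pfcard_geP[AE|]; first by move: A0; rewrite AE => -[].
by move=> /surjfunPex[g ->]; exists g.
Qed.

Lemma card_le_inj {T U : Type} (A : set T) (B : set U) (f : T -> U) :
  (forall a, A a -> B (f a)) -> (forall a b, A a -> A b -> f a = f b -> a = b) ->
  A #<= B.
Proof.
move=> fAB fI; have <- : (f @` A #<= B) = (A #<= B).
  by apply: card_le_eql; apply: inj_card_eq => a b /set_mem Aa /set_mem Ab; exact: fI.
by apply: subset_card_le => _ [a Aa <-]; exact: fAB.
Qed.

Lemma card_le_setX {T U V W : Type} (A : set T) (B : set U) (A' : set V) (B' : set W) :
  A #<= A' -> B #<= B' -> A `*` B #<= A' `*` B'.
Proof.
move=> AA' BB'.
have [->|/set0P[a Aa]] := eqVneq A set0; first by rewrite set0X card_ge0.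
have [->|/set0P[b Bb]] := eqVneq B set0; first by rewrite setX0 card_ge0.
have [|f fE] := card_le_ex_surj _ AA'; first by exists a.
have [|g gE] := card_le_ex_surj _ BB'; first by exists b.
apply: (@card_le_surj _ _ _ _ (fun p => (f p.1, g p.2))) => -[x y] /= [].
rewrite -fE -gE => -[x' Ax' <-] [y' By' <-].
by exists (x', y').
Qed.

Lemma card_le_bigcup {I T U : Type} (A : set I) (F : I -> set T) (K : set U) :
  A #<= K -> (forall i, A i -> F i #<= K) -> K `*` K #<= K ->
  \bigcup_(i in A) F i #<= K.
Proof.
move=> AK FK KK; apply: card_le_trans KK.
have [->|/set0P[t0 [i0 Ai0 _]]] := eqVneq (\bigcup_(i in A) F i) set0.
  by rewrite card_ge0.
have [|h hE] := card_le_ex_surj _ AK; first by exists i0.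
have gP i : exists g : U -> T, A i -> F i `<=` g @` K.
  have [Ai|nAi] := pselect (A i); last by exists (fun=> t0).
  have [FE|/set0P F0] := eqVneq (F i) set0; first by exists (fun=> t0) => _; rewrite FE.
  by have [g gE] := card_le_ex_surj F0 (FK i Ai); exists g => _; rewrite gE.
have [g {}gP] := choice gP.
apply: (@card_le_surj _ _ _ _ (fun p => g (h p.1) p.2)) => t [i Ai Fit].
have := Ai; rewrite -hE => -[k Kk hk].
by have [l Kl gl] := gP i Ai t Fit; exists (k, l) => //=; rewrite hk.
Qed.

(** Hilbert's hotel: [i] is a section of a surjection of [A] onto the natural numbers, and [g] sends
    [i 0] to [x], [i n.+1] to [i n], and fixes everything else. *)
Lemma card_le_setU1 {T : Type} (A : set T) (x : T) :
  infinite_set A -> A `|` [set x] #<= A.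
Proof.
move=> /infiniteP natA.
have [|f fE] := card_le_ex_surj _ (card_le_trans natA (card_lexx A)).
  by exists 0.
have iP n : exists a, A a /\ f a = n by have : [set: nat] n by []; rewrite -fE => -[a]; exists a.
have [i {}iP] := choice iP.
pose g a := if f a is n.+1 then (if pselect (a = i n.+1) then i n else a)
            else (if pselect (a = i 0) then x else a).
have [Ai fi] : (forall n, A (i n)) /\ (forall n, f (i n) = n).
  by split=> n; case: (iP n).
apply: (@card_le_surj _ _ _ _ g) => a [Aa|->]; last first.
  by exists (i 0) => //; rewrite /g fi; case: pselect.
have [E|nE] := pselect (a = i (f a)).
  by exists (i (f a).+1) => //; rewrite /g fi; case: pselect.
exists a => //; rewrite /g; case fa : (f a) => [|n].
  by case: pselect => // E; case: nE; rewrite fa.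
by case: pselect => // E; case: nE; rewrite fa.
Qed.

(* Each element of [X] is sent to a value of [Y] not taken by its predecessors. *)
Lemma card_le_wo_embed {T U : Type} (R : T -> T -> Prop) (X : set T) (Y : set U) :
  well_founded R -> (forall p q, X p -> X q -> [\/ p = q, R p q | R q p]) ->
  (forall p, X p -> ~ (Y #<= [set q | X q /\ R q p])) -> X #<= Y.
Proof.
move=> wfR totR smallR.
have [->|/set0P[p0 Xp0]] := eqVneq X set0; first by rewrite card_ge0.
have [u0 Yu0] : Y !=set0.
  by apply/set0P/negP => /eqP YE; apply: (smallR _ Xp0); rewrite YE card_ge0.
have selP (Z : set U) : exists u, (Y `\` Z) !=set0 -> (Y `\` Z) u.
  have [[u ?]|] := pselect ((Y `\` Z) !=set0); first by exists u.
  by exists u0.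
have [sel {}selP] := choice selP.
have [f fE] := wf_recursion (fun _ G => sel [set u | exists2 q, X q & G (q, u)]) wfR.
have fP p : X p -> (Y `\` f @` [set q | X q /\ R q p]) (f p).
  move=> Xp; rewrite fE.
  have -> : [set u | exists2 q, X q & [set p1 | R p1.1 p /\ p1.2 = f p1.1] (q, u)] =
     f @` [set q | X q /\ R q p].
    apply/seteqP; split=> u /=; first by move=> [q Xq [Rq ->]]; exists q.
    by move=> [q [Xq Rq] <-]; exists q.
  apply: selP; apply: contrapT => E; apply: (smallR _ Xp).
  apply: (@card_le_surj _ _ _ _ f) => u Yu.
  by apply: contrapT => nu; apply: E; exists u.
apply: (@card_le_inj _ _ _ _ f) => [p /fP[]//|p q Xp Xq fpq].
have [//|Rpq|Rqp] := totR _ _ Xp Xq.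
  by have [_ []] := fP _ Xq; exists p.
by have [_ []] := fP _ Xp; exists q.
Qed.

(** * Regular cardinals *)

Section Ordinals.
Context {d : Order.disp_t} {O : orderType d}.
Hypothesis wfO : well_ordered O.
Implicit Types a b c k r t : O.

Lemma ex_least (P : set O) : P !=set0 -> exists2 a, P a & forall b, P b -> (a <= b)%O.
Proof.
move=> [a Pa]; apply: contrapT => H; elim/(well_founded_ind wfO): a Pa => a IH Pa.
apply: H; exists a => // b Pb; rewrite leNgt; apply/negP => ba; exact: IH Pb.
Qed.

Lemma seg_le a b : (a <= b)%O -> seg a #<= seg b.
Proof. by move=> ab; apply: subset_card_le => c /= /lt_le_trans; apply. Qed.

(* Exhaust [X] along the well-order: either this takes [k] steps or it stops
   before stage [k]. *)
Lemma seg_le_or_lt {T : Type} k (X : set T) :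
  ~ (seg k #<= X) -> exists2 t, (t < k)%O & X #<= seg t.
Proof.
move=> nkX; apply: contrapT => H; apply: nkX.
apply: (card_le_wo_embed (R := fun a b => (a < b)%O)) => //.
  by move=> p q _ _; case: (ltgtP p q) => [?|?|?]; [constructor 2|constructor 3|constructor 1].
move=> p pk Xp; apply: H; exists p => //; apply: card_le_trans Xp _.
by apply: subset_card_le => q [].
Qed.

Lemma card_seg_total {T : Type} k (X : set T) : seg k #<= X \/ X #<= seg k.
Proof.
have [|/seg_le_or_lt[t tk Xt]] := pselect (seg k #<= X); first by left.
by right; apply: card_le_trans Xt (seg_le (ltW tk)).
Qed.

(** Pairs are compared by maximum, then lexicographically, so the predecessors of a pair with
    maximum [m] lie in the square of the closed segment up to [m]. *)
Definition godel_lt (p q : O * O) : Prop :=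
  let m (p : O * O) := Order.max p.1 p.2 in
  (m p < m q)%O \/ m p = m q /\ ((p.1 < q.1)%O \/ p.1 = q.1 /\ (p.2 < q.2)%O).

Lemma godel_lt_wf : well_founded godel_lt.
Proof.
suff H m x y : Order.max x y = m -> Acc godel_lt (x, y).
  by case=> x y; exact: H erefl.
elim/(well_founded_ind wfO): m x y => m IHm x.
elim/(well_founded_ind wfO): x => x IHx y.
elim/(well_founded_ind wfO): y => y IHy mE.
constructor=> -[x' y'] [|[]] /= => [h|mE' [xx'|[e yy']]].
- by rewrite mE in h; exact: IHm h _ _ erefl.
- by apply: IHx => //; rewrite mE' mE.
- by subst x'; apply: IHy => //; rewrite mE' mE.
Qed.

Lemma godel_lt_total p q : [\/ p = q, godel_lt p q | godel_lt q p].
Proof.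
case: p q => [x y] [x' y']; rewrite /godel_lt /=.
case: (ltgtP (Order.max x y) (Order.max x' y')) => m; [by constructor 2; left|by constructor 3; left|].
case: (ltgtP x x') => xx'; [by constructor 2; right; split=> //; left|by constructor 3; right; split=> //; left|].
case: (ltgtP y y') => yy'; [by constructor 2; right; split=> //; right|by constructor 3; right; split=> //; right|].
by constructor 1; rewrite xx' yy'.
Qed.

(** Hessenberg's theorem. If [seg a] injects into a smaller segment, induction applies there.
    Otherwise the square embeds along [godel_lt]: the predecessors of a pair lie in the square of
    some [m + 1] with [m < a], which is finite or, by induction, no larger than [seg m]. *)
Lemma card_seg_setX a : infinite_set (seg a) -> seg a `*` seg a #<= seg a.
Proof.
elim/(well_founded_ind wfO): a => a IH ainf.
have [[b ba ab]|Hinit] := pselect (exists2 b, (b < a)%O & seg a #<= seg b).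
  apply: card_le_trans (card_le_setX ab ab) _.
  apply: card_le_trans (IH b ba _) (seg_le (ltW ba)).
  by move=> bfin; apply: ainf; exact: card_le_finite ab bfin.
apply: (card_le_wo_embed godel_lt_wf) => [p q _ _|[x y] /= [xa ya] H].
  exact: godel_lt_total.
pose m := Order.max x y; have ma : (m < a)%O by rewrite /m gt_max xa ya.
pose Y := seg m `|` [set m].
have {}H : seg a #<= Y `*` Y.
  apply: card_le_trans H _; apply: subset_card_le => -[x' y'] /= [_ h].
  have : (Order.max x' y' <= m)%O by case: h => [/ltW//|[-> _]].
  rewrite ge_max => /andP[]; rewrite /Y /seg/=.
  by rewrite !le_eqVlt => /orP[/eqP->|->] /orP[/eqP->|->]; split; by [left|right].
have [mfin|minf] := pselect (finite_set (seg m)).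
  apply: ainf; apply: card_le_finite H _; apply: finite_setX; rewrite /Y finite_setU;
  by split=> //; exact: finite_set1.
apply: Hinit; exists m => //; apply: card_le_trans H _.
have Ym : Y #<= seg m by exact: card_le_setU1.
exact: card_le_trans (card_le_setX Ym Ym) (IH _ ma minf).
Qed.

(* For a cardinal [r], this says that [X] has cardinality less than [r]. *)
Definition small {T : Type} r (X : set T) : Prop := ~ (seg r #<= X).

Lemma small_le {T U : Type} r (X : set T) (Y : set U) : X #<= Y -> small r Y -> small r X.
Proof. by move=> XY rY rX; apply: rY; exact: card_le_trans rX XY. Qed.

Lemma small_image {T U : Type} r (f : T -> U) (X : set T) : small r X -> small r (f @` X).
Proof. by apply: small_le; exact: card_image_le. Qed.

Lemma smallE {T : Type} r (X : set T) : card_lt X (seg r) <-> small r X.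
Proof.
split=> [[]//|rX]; split=> //.
by have [//|] := card_seg_total r X.
Qed.

Lemma small_seg r t : is_cardinal r -> (t < r)%O -> small r (seg t).
Proof.
move=> rc tr h; apply: (rc t tr); rewrite card_eq_le h andbT.
exact: seg_le (ltW tr).
Qed.

Lemma small_finite r {T : Type} (X : set T) :
  infinite_set (seg r) -> finite_set X -> small r X.
Proof. by move=> rinf Xfin rX; apply: rinf; exact: card_le_finite rX Xfin. Qed.

Lemma small_setX {T U : Type} r (X : set T) (Y : set U) :
  is_cardinal r -> infinite_set (seg r) -> small r X -> small r Y -> small r (X `*` Y).
Proof.
move=> rc rinf /seg_le_or_lt[s sr Xs] /seg_le_or_lt[t tr Yt].
pose m := Order.max s t; have mr : (m < r)%O by rewrite /m gt_max sr tr.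
have Xm : X #<= seg m by apply: card_le_trans Xs _; apply: seg_le; rewrite /m le_max lexx.
have Ym : Y #<= seg m by apply: card_le_trans Yt _; apply: seg_le; rewrite /m le_max lexx orbT.
apply: small_le (card_le_setX Xm Ym) _.
have [mfin|minf] := pselect (finite_set (seg m)).
  by apply: small_finite => //; exact: finite_setX.
exact: small_le (card_seg_setX minf) (small_seg rc mr).
Qed.

(** Regularity as strict boundedness of small subsets, the form used from here on;
    [regular_cardinal_regular] and [regular_cofinality] link it to cofinal maps. *)
Definition regular r : Prop :=
  [/\ is_cardinal r, infinite_set (seg r)
    & forall X, X `<=` seg r -> small r X ->
        exists2 b, (b < r)%O & forall c, X c -> (c < b)%O].

Lemma unboundedPn a (X : set O) : X `<=` seg a ->
  ~ unbounded_in a X -> exists2 b, (b < a)%O & forall c, X c -> (c < b)%O.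
Proof.
move=> Xa H; apply: contrapT => H'; apply: H; split=> // b ba.
apply: contrapT => H; apply: H'; exists b => // c Xc.
by rewrite ltNge; apply/negP => bc; apply: H; exists c.
Qed.

Lemma regular_cardinal_regular r : regular_cardinal r -> regular r.
Proof.
move=> [[rc rinf] [_ rcof]]; split=> // X Xr Xs.
apply: unboundedPn => // Xunb.
have X0 : X !=set0.
  have [a ar] := infinite_setN0 rinf.
  by have [_ /(_ a ar)[c Xc _]] := Xunb; exists c.
have [t tr Xt] := seg_le_or_lt Xs.
have [f fE] := card_le_ex_surj X0 Xt.
suff : (r <= t)%O by rewrite leNgt tr.
by apply: rcof; exists f; rewrite /cofinal_map fE.
Qed.

Lemma regular_cofinality r : regular r -> is_cofinality r r.
Proof.
move=> [rc rinf rreg]; split.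
  exists id; rewrite /cofinal_map image_id; split=> // b br.
  by exists b.
move=> t [f [ftr funb]]; rewrite leNgt; apply/negP => tr.
have [|b br bP] := rreg _ ftr; first exact: small_image (small_seg rc tr).
by have [c fc] := funb _ br; rewrite leNgt (bP _ fc).
Qed.

Lemma ex_cardinal a : exists c, [/\ is_cardinal c, (c <= a)%O & seg a #<= seg c].
Proof.
have [|c ac cmin] := @ex_least [set c | seg a #<= seg c]; first by exists a => /=.
exists c; split=> //; last by apply: cmin; exact: card_lexx.
move=> b bc /card_eqPle[_ cb]; have := cmin b (card_le_trans ac cb).
by rewrite leNgt bc.
Qed.

Lemma card_lt_succ k k' a : is_succ_cardinal k k' -> (a < k')%O -> seg a #<= seg k.
Proof.
move=> [_ _ kmin] ak'; have [c [cc ca ac]] := ex_cardinal a.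
apply: card_le_trans ac (seg_le _); rewrite leNgt; apply/negP => /(kmin _ cc).
by rewrite leNgt (le_lt_trans ca ak').
Qed.

(** An unbounded small [X] would have size at most [k] and cover [k'] by at most [k] closed segments
    of size at most [k], whence [k'] would inject into [k]. *)
Lemma regular_succ k k' : infinite_set (seg k) -> is_succ_cardinal k k' -> regular k'.
Proof.
move=> kinf kk'; have [k'c ltkk' kmin] := kk'; split=> //.
  by move=> k'fin; apply: kinf; exact: card_le_finite (seg_le (ltW ltkk')) k'fin.
move=> X Xk' Xs; apply: unboundedPn => // -[_ Xunb].
have Xk : X #<= seg k.
  have [t tk' Xt] := seg_le_or_lt Xs.
  exact: card_le_trans Xt (card_lt_succ kk' tk').
apply: (small_seg k'c ltkk').
apply: card_le_trans (card_le_bigcup Xk (F := fun a => seg a `|` [set a]) _ (card_seg_setX kinf)).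
  apply: subset_card_le => b /Xunb[c Xc bc]; exists c => //.
  by move: bc; rewrite le_eqVlt => /orP[/eqP->|bc]; [right|left].
move=> a Xa; have ak := card_lt_succ kk' (Xk' _ Xa).
have [afin|ainf] := pselect (finite_set (seg a)); last first.
  exact: card_le_trans (card_le_setU1 a ainf) ak.
have [ka|//] := card_seg_total k (seg a `|` [set a]).
by case: kinf; apply: card_le_finite ka _; rewrite finite_setU; split=> //; exact: finite_set1.
Qed.

Lemma ex_succ_cardinal k l : is_cardinal l -> (k < l)%O ->
  exists2 k', is_succ_cardinal k k' & (k' <= l)%O.
Proof.
move=> lc kl.
have [|k' [k'c kk'] kmin] := @ex_least [set c | is_cardinal c /\ (k < c)%O]; first by exists l.
by exists k'; [split=> // c cc kc; exact: kmin|exact: kmin].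
Qed.


Lemma regular_bound {T : Type} r (X : set T) (f : T -> O) :
  regular r -> small r X -> (forall x, X x -> (f x < r)%O) ->
  exists2 b, (b < r)%O & forall x, X x -> (f x < b)%O.
Proof.
move=> [_ _ rreg] Xs fr.
have [|b br bP] := rreg (f @` X) _ (small_image Xs).
  by move=> _ [x Xx <-]; exact: fr.
by exists b => // x Xx; apply: bP; exists x.
Qed.

Lemma regular_lt r a : regular r -> (a < r)%O -> exists2 b, (a < b)%O & (b < r)%O.
Proof.
move=> rr ar; have [_ rinf _] := rr.
have [||b br bP] := @regular_bound _ r [set a] id rr; last by exists b => //; exact: bP.
  by apply: small_finite => //; exact: finite_set1.
by move=> _ ->.
Qed.

Lemma regular_small_seg r a : regular r -> (a < r)%O -> small r (seg a).
Proof. by move=> [rc _ _]; exact: small_seg. Qed.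

(** * Clubs and club guessing *)

(* For a regular [k], this says that [cf(a) = k]. *)
Definition has_cofinality k a : Prop :=
  (exists2 C, unbounded_in a C & C #<= seg k) /\
  forall Y, Y `<=` seg a -> small k Y -> exists2 b, (b < a)%O & forall c, Y c -> (c < b)%O.

Lemma has_cofinality_lt k a b : infinite_set (seg k) -> has_cofinality k a ->
  (b < a)%O -> exists2 c, (b < c)%O & (c < a)%O.
Proof.
move=> kinf [_ acof] ba; have [||c ca cP] := acof [set b].
- by move=> _ ->.
- by apply: small_finite => //; exact: finite_set1.
- by exists c => //; exact: cP.
Qed.

Lemma has_cofinality_limit k a : infinite_set (seg k) -> has_cofinality k a -> is_limit a.
Proof.
move=> kinf acof; split; last by move=> b; exact: (has_cofinality_lt kinf).
have [_ H] := acof; have [//||b ba _] := H set0; last by exists b.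
by apply: small_finite => //; exact: finite_set0.
Qed.

(** Iterate a function dominating [F] along [k] and take the supremum. The iteration [h] is strictly
    increasing, so regularity of [k] gives the supremum cofinality [k]. *)
Lemma ex_closure_point k r (F : O -> O) b : regular k -> regular r -> (k < r)%O ->
  (forall a, (a < r)%O -> (F a < r)%O) -> (b < r)%O ->
  exists a, [/\ (b < a)%O, (a < r)%O, has_cofinality k a
    & forall c, (c < a)%O -> (F c < a)%O].
Proof.
move=> kreg rreg kr Fr br.
(* [F] need not be monotone, so [G a] bounds it on the whole closed segment up to [a]. *)
have GP a : exists g, (a < r)%O -> [/\ (g < r)%O, (a < g)%O & forall c, (c <= a)%O -> (F c < g)%O].
  have [ar|nar] := pselect (a < r)%O; last by exists a.
  have [a' aa' a'r] := regular_lt rreg ar.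
  have [|g gr gP] := regular_bound (f := F) rreg (regular_small_seg rreg a'r).
    by move=> x /= /lt_trans/(_ a'r); exact: Fr.
  exists (Order.max g a') => _; split; first by rewrite gt_max gr a'r.
    by rewrite lt_max aa' orbT.
  by move=> c ca; rewrite lt_max gP //=; exact: le_lt_trans aa'.
have [G {}GP] := choice GP.
have BP (X : set O) : exists u, (exists2 u, (u < r)%O & forall x, X x -> (x < u)%O) ->
    (u < r)%O /\ forall x, X x -> (x < u)%O.
  have [[u]|nE] := pselect (exists2 u, (u < r)%O & forall x, X x -> (x < u)%O).
    by move=> ur uP; exists u.
  by exists b.
have [B {}BP] := choice BP.
have [h hE] := wf_recursion (fun _ H => B ([set b] `|` [set G p.2 | p in H])) wfO.
have hP x : (x < r)%O -> [/\ (h x < r)%O, (b < h x)%O & forall y, (y < x)%O -> (G (h y) < h x)%O].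
  elim/(well_founded_ind wfO): x => x IH xr.
  have [|h1 h2] := BP ([set b] `|` [set G p.2 | p in [set p | (p.1 < x)%O /\ p.2 = h p.1]]).
    have [|u ur uP] := regular_bound (f := G \o h) rreg (regular_small_seg rreg xr).
      move=> y yx /=; have yr := lt_trans yx xr.
      by have [hy _ _] := IH _ yx yr; have [] := GP _ hy.
    have [b' bb' b'r] := regular_lt rreg br.
    exists (Order.max u b'); first by rewrite gt_max ur b'r.
    move=> _ [->|[[y z]/= [yx ->] <-]]; rewrite lt_max ?bb' ?orbT //.
    by rewrite (uP y yx).
  rewrite -hE in h1 h2; split=> //; first by apply: h2; left.
  by move=> y yx; apply: h2; right; exists (y, h y).
have hinc x y : (x < y)%O -> (y < r)%O -> (h x < h y)%O.
  move=> xy yr; have [hx _ _] := hP _ (lt_trans xy yr).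
  have [_ hG _] := GP _ hx; apply: lt_trans hG _.
  by have [_ _] := hP _ yr; apply.
have kltr x : (x < k)%O -> (x < r)%O by move=> /lt_trans; apply.
have [|u ur uP] := regular_bound (f := h) rreg (regular_small_seg rreg kr).
  by move=> x /kltr/hP[].
have [|a aP amin] := @ex_least [set a | forall x, (x < k)%O -> (h x < a)%O]; first by exists u.
have ar : (a < r)%O by apply: le_lt_trans ur; exact: amin.
have aleast c : (c < a)%O -> exists2 x, (x < k)%O & (c <= h x)%O.
  move=> ca; apply: contrapT => H; suff : (a <= c)%O by rewrite leNgt ca.
  by apply: amin => x xk; rewrite ltNge; apply/negP => cx; apply: H; exists x.
have [kc kinf _] := kreg; have [x0 x0k] := infinite_setN0 kinf.
exists a; split=> //.
- by apply: lt_trans (aP _ x0k); have [] := hP _ (kltr _ x0k).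
- split; first exists (h @` seg k); [split| |].
  + by move=> _ [x xk <-]; exact: aP.
  + by move=> c /aleast[x xk cx]; exists (h x) => //; exists x.
  + exact: card_image_le.
  + move=> Y Ya Ys.
    have iP y : exists x, Y y -> (x < k)%O /\ (y <= h x)%O.
      have [Yy|nY] := pselect (Y y); last by exists b.
      by have [x] := aleast _ (Ya _ Yy); exists x.
    have [i {}iP] := choice iP.
    have [|x xk xP] := regular_bound (f := i) kreg Ys; first by move=> y /iP[].
    exists (h x); first exact: aP.
    move=> y Yy; have [_ yh] := iP _ Yy; apply: le_lt_trans yh _.
    by apply: hinc; [exact: xP|exact: kltr].
- move=> c /aleast[x xk cx]; have [y xy yk] := regular_lt kreg xk.
  have [hx _ _] := hP _ (kltr _ xk); have [_ _ /(_ _ cx) Fc] := GP _ hx.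
  apply: lt_trans Fc _; apply: lt_trans (aP _ yk).
  by have [_ _] := hP _ (kltr _ yk); apply.
Qed.

Lemma club_next r (E : set O) a : regular r -> is_club r E -> (a < r)%O ->
  exists e, [/\ E e, (a < e)%O & (e < r)%O].
Proof.
move=> rreg [[Er Eunb] _] ar; have [a' aa' a'r] := regular_lt rreg ar.
have [e Ee a'e] := Eunb _ a'r; exists e; split=> //; last exact: Er.
exact: lt_le_trans a'e.
Qed.

(** For unboundedness, take a closure point of an [F] that, from each [a], passes the next element
    of every [E i]. It has cofinality [k], hence is a limit at which every [E i] is unbounded. *)
Lemma club_bigcap {T : Type} k r (I : set T) (E : T -> set O) :
  regular k -> regular r -> (k < r)%O -> small r I ->
  (forall i, I i -> is_club r (E i)) ->
  is_club r [set a | (a < r)%O /\ forall i, I i -> E i a].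
Proof.
move=> kreg rreg kr Is Ec; split; last first.
  move=> g gr glim [_ gunb]; split=> // i Ii; have [_] := Ec _ Ii; apply=> //.
  split; first by move=> c [].
  by move=> b /gunb[c [[cr cE] cg] bc]; exists c => //; split=> //; exact: cE.
split; first by move=> a [].
move=> b br.
have NP (p : T * O) : exists e, I p.1 -> (p.2 < r)%O ->
    [/\ E p.1 e, (p.2 < e)%O & (e < r)%O].
  case: p => i a /=; have [[Ii ar]|nE] := pselect (I i /\ (a < r)%O); last first.
    by exists b => Ii ar; case: nE.
  by have [e] := club_next rreg (Ec _ Ii) ar; exists e.
have [N {}NP] := choice NP.
have FP a : exists u, (a < r)%O -> (u < r)%O /\ forall i, I i -> (N (i, a) < u)%O.
  have [ar|nE] := pselect (a < r)%O; last by exists b.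
  have [|u ur uP] := regular_bound (f := fun i => N (i, a)) rreg Is; last by exists u.
  by move=> i Ii; have [] := NP (i, a) Ii ar.
have [F {}FP] := choice FP.
have [|a [ba ar acof aF]] := ex_closure_point (F := F) kreg rreg kr _ br.
  by move=> a /FP[].
have [_ kinf _] := kreg.
exists a; last exact: ltW; split=> // i Ii.
have [_] := Ec _ Ii; apply=> //; first exact: has_cofinality_limit acof.
split; first by move=> c [].
move=> c ca; have cr := lt_trans ca ar; have [Ee ce _] := NP (i, c) Ii cr.
exists (N (i, c)); last exact: ltW.
split=> //; apply: lt_trans (aF _ ca); have [_] := FP _ cr; exact.
Qed.

Definition is_max_below (E : set O) b e : Prop :=
  [/\ E e, (e <= b)%O & forall e', E e' -> (e' <= b)%O -> (e' <= e)%O].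

(** The least upper bound [s] of the part of [E] up to [b] belongs to [E]: otherwise it would be a
    limit of points of [E], and closure would put it there. *)
Lemma club_max r (E : set O) b e : is_club r E -> (b < r)%O -> E e -> (e <= b)%O ->
  exists m, is_max_below E b m.
Proof.
move=> [[Er _] Ecl] br Ee eb.
have [|s sP smin] := @ex_least [set s | forall e', E e' -> (e' <= b)%O -> (e' <= s)%O].
  by exists b.
have sb : (s <= b)%O by apply: smin.
exists s; split=> //; apply: contrapT => nEs.
have lts e' : E e' -> (e' <= b)%O -> (e' < s)%O.
  move=> Ee' e'b; rewrite lt_neqAle sP // andbT; apply/eqP => e's.
  by apply: nEs; rewrite -e's.
have sunb c : (c < s)%O -> exists e', [/\ E e', (c < e')%O & (e' < s)%O].
  move=> cs; apply: contrapT => H; suff : (s <= c)%O by rewrite leNgt cs.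
  apply: smin => e' Ee' e'b; rewrite leNgt; apply/negP => ce'.
  by apply: H; exists e'; split=> //; exact: lts.
apply: nEs; apply: Ecl; first exact: le_lt_trans br.
  split; first by exists e; exact: lts.
  by move=> c /sunb[e' [_ ce' e's]]; exists e'.
split; first by move=> c [].
by move=> c /sunb[e' [Ee' ce' e's]]; exists e' => //; exact: ltW.
Qed.

(** Each point of [C] is pushed down to the last point of [E] not above it; a point with no such
    predecessor contributes nothing. *)
Definition club_trace (E C : set O) : set O :=
  [set e | exists2 b, C b & is_max_below E b e].

Lemma club_trace_unbounded r (E C : set O) a : is_club r E -> (a < r)%O ->
  unbounded_in a (E `&` seg a) -> unbounded_in a C -> unbounded_in a (club_trace E C).
Proof.
move=> Ec ar [_ Eunb] [Ca Cunb]; split.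
  by move=> e [b Cb [_ eb _]]; apply: le_lt_trans eb (Ca _ Cb).
move=> c /Eunb[e [Ee ea] ce]; have [b Cb eb] := Cunb _ ea.
have [m mP] := club_max Ec (lt_trans (Ca _ Cb) ar) Ee eb.
exists m; first by exists b.
by apply: le_trans ce _; have [_ _] := mP; apply.
Qed.

(* Shelah's club guessing: if every attempt fails, iterate [k1] times the
   replacement of the guesses by their traces on a club that they miss.  For
   each point of a set of size [k < k1] the trace only decreases, hence it is
   eventually constant, and the stable traces are contained in the next club. *)
Lemma club_guessing k k1 r : regular k -> regular k1 -> regular r ->
  (k < k1)%O -> (k1 < r)%O ->
  exists c : O -> set O, forall E, is_club r E ->
    exists a, [/\ (a < r)%O, has_cofinality k a, unbounded_in a (c a) & c a `<=` E].
Proof.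
move=> kreg k1reg rreg kk1 k1r; have kr := lt_trans kk1 k1r.
have [_ kinf _] := kreg.
have CP a : exists C, has_cofinality k a -> unbounded_in a C /\ C #<= seg k.
  have [[[C]]|nE] := pselect (has_cofinality k a); last by exists set0.
  by exists C.
have [C {}CP] := choice CP.
apply: contrapT => H.
have NP (c : O -> set O) : exists E, is_club r E /\ forall a, (a < r)%O ->
    has_cofinality k a -> unbounded_in a (c a) -> ~ (c a `<=` E).
  apply: contrapT => H'; apply: H; exists c => E Ec.
  apply: contrapT => H; apply: H'; exists E; split=> // a ar acof aunb aE.
  by apply: H; exists a.
have [N {}NP] := choice NP.
pose Nx E := N (fun a => club_trace E (C a)).
(* Stage [v] intersects, over all [u < v], the clubs that defeat the traces on [E u]. *)
have [E EE] := wf_recursion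
  (fun _ (G : set (O * set O)) => [set a | (a < r)%O /\ forall p, G p -> Nx p.2 a]) wfO.
have {}EE v : E v = [set a | (a < r)%O /\ forall u, seg v u -> Nx (E u) a].
  rewrite [LHS]EE; apply/seteqP; split=> a [ar aP]; split=> //.
    by move=> u uv; exact: (aP (u, E u)).
  by move=> [u x] /= [uv ->]; exact: aP.
have Edec u v : (u <= v)%O -> E v `<=` E u.
  move=> uv a; rewrite !EE => -[ar aP]; split=> // w wu; apply: aP.
  exact: lt_le_trans wu uv.
have Ec v : (v < r)%O -> is_club r (E v).
  move=> vr; rewrite EE; apply: (club_bigcap kreg) => //.
    exact: regular_small_seg.
  by move=> u _; have [] := NP (fun a => club_trace (E u) (C a)).
have nextP a : exists e, (a < r)%O -> [/\ E k1 e, (a < e)%O & (e < r)%O].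
  have [ar|nE] := pselect (a < r)%O; last by exists a.
  by have [e] := club_next rreg (Ec _ k1r) ar; exists e.
have [next {}nextP] := choice nextP.
(* At this [a] the smallest club [E k1] is unbounded, hence so is every [E v] with [v <= k1]. *)
have [|a [_ ar acof aF]] := ex_closure_point (F := next) kreg rreg kr _ kr.
  by move=> a /nextP[].
have [[Ca Cunb] Ck] := CP a acof.
have Eunb v : (v <= k1)%O -> unbounded_in a (E v `&` seg a).
  move=> vk1; split; first by move=> c [].
  move=> c ca; have [Ee ce _] := nextP _ (lt_trans ca ar).
  exists (next c); last exact: ltW.
  by split; [exact: (Edec _ _ vk1)|exact: aF].
(* The maximum of [E u] up to [b] decreases with [u], so it is constant from a stage where it is
   least. Stating only that it stays in [E u'] also covers, vacuously, the case where some [E v] has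
   no point up to [b]. *)
have stabP b : exists v, C a b -> (v < k1)%O /\ forall u u' e,
    (v <= u)%O -> (u <= u')%O -> (u' < k1)%O -> is_max_below (E u) b e -> E u' e.
  have [Cb|nE] := pselect (C a b); last by exists b.
  have [[v vk1 vP]|vP] := pselect (exists2 v, (v < k1)%O & forall e, E v e -> ~ (e <= b)%O).
    exists v => _; split=> // u u' e vu _ _ [Ee eb _].
    by case: (vP e) => //; exact: (Edec _ _ vu).
  have maxP v : (v < k1)%O -> exists e, is_max_below (E v) b e.
    move=> vk1; have [e Ee eb] : exists2 e, E v e & (e <= b)%O.
      apply: contrapT => H'; apply: vP; exists v => // e Ee eb.
      by apply: H'; exists e.
    by apply: club_max Ee eb; [exact: Ec (lt_trans vk1 k1r)|exact: lt_trans (Ca _ Cb) ar].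
  have [|e [v vk1 emax] emin] :=
      @ex_least [set e | exists2 v, (v < k1)%O & is_max_below (E v) b e].
    by have [e] := maxP k kk1; exists e, k.
  have eE u e' : (v <= u)%O -> (u < k1)%O -> is_max_below (E u) b e' -> e' = e.
    move=> vu uk1 e'max; apply/eqP; rewrite eq_le emin ?andbT; last by exists u.
    have [_ _] := emax; apply; last by case: e'max.
    by apply: (Edec _ _ vu); case: e'max.
  exists v => _; split=> // u u' e' vu uu' u'k1 e'max.
  have [e2 e2max] := maxP _ u'k1.
  rewrite (eE _ _ vu (le_lt_trans uu' u'k1) e'max).
  by rewrite -(eE _ _ (le_trans vu uu') u'k1 e2max); case: e2max.
have [st {}stabP] := choice stabP.
have Cs : small k1 (C a) by apply: small_le Ck _; exact: regular_small_seg.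
(* Since [C a] has size at most [k < k1], one stage [v] serves all its points. The trace on [E v]
   then lies in the next club [E v'], hence in the club chosen to defeat it. *)
have [|v vk1 vP] := regular_bound (f := st) k1reg Cs; first by move=> b /stabP[].
have [v' vv' v'k1] := regular_lt k1reg vk1.
have [_ /(_ a ar acof)] := NP (fun a => club_trace (E v) (C a)); apply.
  apply: (@club_trace_unbounded r) => //; last exact: Eunb (ltW vk1).
  exact: Ec (lt_trans vk1 k1r).
move=> e [b Cb emax]; have [_ /(_ v v' e)] := stabP _ Cb.
move=> /(_ (ltW (vP _ Cb)) (ltW vv') v'k1 emax).
by rewrite EE => -[_ /(_ v vv')].
Qed.


(** * Continuous sequences *)

Definition graph_upto (f : O -> O) a : set (O * O) := [set p | (p.1 <= a)%O /\ p.2 = f p.1].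

Definition increasing_upto r (f : O -> O) : Prop :=
  forall a b, (a < b)%O -> (b <= r)%O -> (f a < f b)%O.

Definition continuous_upto r (f : O -> O) : Prop :=
  forall a g, is_limit a -> (a <= r)%O -> (g < f a)%O -> exists2 b, (b < a)%O & (g < f b)%O.

(** [W a] collects demands, computed from the values up to [a], that all later values must exceed.
    Let [f a] be the least strict upper bound of the earlier values and demands. At a limit [a] the
    demands made at [b] are already below [f c] whenever [b < c < a], which gives continuity. *)
Lemma ex_continuous_sequence r l (W : O -> set (O * O) -> set O) :
  regular l -> (r < l)%O ->
  (forall f a, (a < r)%O -> (forall b, (b <= a)%O -> (f b < l)%O) ->
     exists2 u, (u < l)%O & forall w, W a (graph_upto f a) w -> (w < u)%O) ->
  exists f, [/\ forall a, (a <= r)%O -> (f a < l)%O,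
    increasing_upto r f, continuous_upto r f
    & forall a b w, (a < b)%O -> (b <= r)%O -> W a (graph_upto f a) w -> (w < f b)%O].
Proof.
move=> lreg rl Wl.
have supP (X : set O) : exists s, (exists u, forall x, X x -> (x < u)%O) ->
    (forall x, X x -> (x < s)%O) /\ forall u, (forall x, X x -> (x < u)%O) -> (s <= u)%O.
  have [[u uP]|nE] := pselect (exists u, forall x, X x -> (x < u)%O); last by exists r.
  by have [|s] := @ex_least [set u | forall x, X x -> (x < u)%O]; [exists u|exists s].
have [sup {}supP] := choice supP.
(* The recursion supplies the graph below [a]; [W b] must see only its part up to [b]. *)
pose below a (G : set (O * O)) : set O := [set w | exists2 b, (b < a)%O &
  G (b, w) \/ W b (G `&` [set p | (p.1 <= b)%O]) w].
have [f fE] := wf_recursion (fun a G => sup (below a G)) wfO.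
pose U a : set O := [set w | exists2 b, (b < a)%O & w = f b \/ W b (graph_upto f b) w].
have cutE a b : (b < a)%O -> [set p | (p.1 < a)%O /\ p.2 = f p.1] `&`
    [set p | (p.1 <= b)%O] = graph_upto f b.
  move=> ba; apply/seteqP; split=> p; first by move=> [[_ pE] pb].
  by move=> [pb pE]; split=> //; split=> //; exact: le_lt_trans ba.
have {}fE a : f a = sup (U a).
  rewrite [LHS]fE; congr (sup _); apply/seteqP; split=> w [b ba].
    by rewrite cutE // => -[[_ /= ->]|wP]; exists b => //; [left|right].
  by move=> [->|wP]; exists b => //; [left|right; rewrite cutE].
have fP a : (a <= r)%O -> exists2 u, (u < l)%O & forall w, U a w -> (w < u)%O.
  elim/(well_founded_ind wfO): a => a IH ar.
  have fl b : (b < a)%O -> (f b < l)%O.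
    move=> ba; have [u ul uP] := IH _ ba (ltW (lt_le_trans ba ar)).
    apply: le_lt_trans ul; rewrite fE.
    by have [|_] := supP (U b); [exists u|apply].
  have gP b : exists u, (b < a)%O -> (u < l)%O /\ forall w, W b (graph_upto f b) w -> (w < u)%O.
    have [ba|nE] := pselect (b < a)%O; last by exists b.
    have [|u] := Wl f b (lt_le_trans ba ar); last by exists u.
    by move=> c cb; apply: fl; exact: le_lt_trans ba.
  have [g {}gP] := choice gP.
  have asmall : small l (seg a) by apply: regular_small_seg => //; exact: le_lt_trans rl.
  have [|u ul uP] := regular_bound (f := f) lreg asmall; first by move=> b; exact: fl.
  have [|v vl vP] := regular_bound (f := g) lreg asmall; first by move=> b /gP[].
  exists (Order.max u v); first by rewrite gt_max ul vl.
  move=> w [b ba [->|wP]]; rewrite lt_max; first by rewrite uP.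
  by have [_ /(_ w wP) wg] := gP _ ba; rewrite (lt_trans wg (vP _ ba)) orbT.
have fsup a : (a <= r)%O -> (forall x, U a x -> (x < f a)%O) /\
    forall u, (forall x, U a x -> (x < u)%O) -> (f a <= u)%O.
  by move=> /fP[u ul uP]; rewrite fE; apply: supP; exists u.
have finc : increasing_upto r f.
  by move=> a b ab /fsup[+ _]; apply; exists a => //; left.
have fW a b w : (a < b)%O -> (b <= r)%O -> W a (graph_upto f a) w -> (w < f b)%O.
  by move=> ab /fsup[+ _] Ww; apply; exists a => //; right.
exists f; split=> // [a ar|a g [_ alim] ar ga].
  by have [u ul uP] := fP _ ar; apply: le_lt_trans ul; have [_] := fsup _ ar; apply.
apply: contrapT => H; have [_ /(_ g)] := fsup _ ar; rewrite leNgt ga => /(_ _)/negP.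
suff gU x : U a x -> (x < g)%O by move/(_ gU).
move=> [b ba bP]; rewrite ltNge; apply/negP => gx; apply: H.
have [c bc ca] := alim _ ba; exists c => //; apply: le_lt_trans gx _.
have cr := ltW (lt_le_trans ca ar).
by case: bP => [->|]; [exact: finc|exact: fW].
Qed.

Lemma continuous_limit r (f : O -> O) a : increasing_upto r f -> continuous_upto r f ->
  is_limit a -> (a <= r)%O -> is_limit (f a).
Proof.
move=> finc fcont alim ar; have [[b ba] _] := alim; split; first by exists (f b); exact: finc.
by move=> g /(fcont _ _ alim ar)[c ca gc]; exists (f c) => //; exact: finc.
Qed.

Lemma regular_is_limit r : regular r -> is_limit r.
Proof.
move=> rreg; have [_ rinf _] := rreg; split; first exact: infinite_setN0 rinf.
by move=> a; exact: regular_lt.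
Qed.

(** For unboundedness, [F a] is chosen so that a point of [C] lies between [f a] and [f (F a)]. At a
    closure point [a] of cofinality [k], continuity makes [f a] a limit of [C]. *)
Lemma club_preimage k r (f : O -> O) (C : set O) : regular k -> regular r -> (k < r)%O ->
  increasing_upto r f -> continuous_upto r f -> is_club (f r) C ->
  is_club r [set a | (a < r)%O /\ C (f a)].
Proof.
move=> kreg rreg kr finc fcont [[Cr Cunb] Ccl].
have [_ kinf _] := kreg.
split; last first.
  move=> g gr glim [_ gunb]; split=> //; apply: Ccl; first exact: finc.
    exact: continuous_limit glim (ltW gr).
  split; first by move=> c [].
  move=> b /(fcont _ _ glim (ltW gr))[c cg bc].
  have [e [[_ Ce] eg] ce] := gunb _ cg.
  exists (f e); first by split=> //; apply: finc => //; exact: ltW.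
  apply: (le_trans (ltW bc)); move: ce; rewrite le_eqVlt => /orP[/eqP->//|ce].
  by apply/ltW/finc => //; exact: ltW (lt_trans eg gr).
split; first by move=> a [].
move=> b br.
have FP a : exists a', (a < r)%O -> (a' < r)%O /\ exists2 c, C c & (f a <= c)%O /\ (c < f a')%O.
  have [ar|nE] := pselect (a < r)%O; last by exists a.
  have [c Cc ac] := Cunb (f a) (finc _ _ ar (lexx _)).
  have [a' a'r ca'] := fcont _ _ (regular_is_limit rreg) (lexx _) (Cr _ Cc).
  by exists a' => _; split=> //; exists c.
have [F {}FP] := choice FP.
have [|a [ba ar acof aF]] := ex_closure_point (F := F) kreg rreg kr _ br.
  by move=> a /FP[].
have alim := has_cofinality_limit kinf acof.
exists a; last exact: ltW.
split=> //; apply: Ccl; [exact: finc|exact: continuous_limit alim (ltW ar)|].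
split; first by move=> c [].
move=> g /(fcont _ _ alim (ltW ar))[c ca gc].
have [_ [e Ce [ce eF]]] := FP _ (lt_trans ca ar).
exists e; last exact: le_trans (ltW gc) ce.
split=> //; apply: lt_trans eF _; apply: finc; [exact: aF|exact: ltW].
Qed.

(** * Covering matrices *)

Section CoveringMatrix.
Context (theta l : O) (D : O -> O -> set O).
Hypotheses (Dcov : covering_matrix theta l D) (Dtr : transitive_matrix theta l D).

Lemma matrix_mono b i j : (b < l)%O -> (i <= j)%O -> (j < theta)%O -> D i b `<=` D j b.
Proof. by case: Dcov => H _ _ bl ij jt; exact: (H _ bl). Qed.

Lemma matrix_ex b g : (b < g)%O -> (g < l)%O -> exists2 i, (i < theta)%O & D i g b.
Proof.
case: Dcov => _ H _ bg gl; have : seg g b by [].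
by rewrite -(H g gl) => -[i it Di]; exists i.
Qed.

(** Once [b] has entered [D i g] it stays in all later [D j g], and transitivity applies. *)
Lemma matrix_eventually_sub b g : (b <= g)%O -> (g < l)%O -> (exists i, (i < theta)%O) ->
  exists2 i, (i < theta)%O & forall j, (i <= j)%O -> (j < theta)%O -> D j b `<=` D j g.
Proof.
rewrite le_eqVlt => /orP[/eqP->|bg] gl [i0 i0t]; first by exists i0 => // j _ _.
have [i it Di] := matrix_ex bg gl; exists i => // j ij jt.
by apply: Dtr => //; exact: matrix_mono Di.
Qed.

(** For each pair [(a, j)] in [x] times [theta] such that [a] enters [D j w] for some [w] in [H],
    fix a witness [w]. There are fewer than [kappa] witnesses, so some [z] in [H] lies above them
    all. From index [k] on the matrix increases along [H] by transitivity, so nothing new enters the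
    traces after [z]. *)
Lemma chain_stable kappa (x H : set O) k : regular kappa -> (theta < kappa)%O ->
  small kappa x -> H `<=` seg l -> (k < theta)%O ->
  (forall z w, H z -> H w -> (z < w)%O -> D k w z) ->
  (forall Y, Y `<=` H -> small kappa Y -> exists2 w, H w & forall z, Y z -> (z < w)%O) ->
  exists2 z, H z & forall w j, H w -> (z < w)%O -> (k <= j)%O -> (j < theta)%O ->
    D j w `&` x = D j z `&` x.
Proof.
move=> kreg tk xs Hl kt Hchain Hdir; have [kc kinf _] := kreg.
have wP (p : O * O) : exists w, (exists2 w, H w & D p.2 w p.1) -> H w /\ D p.2 w p.1.
  have [[w Hw Dw]|nE] := pselect (exists2 w, H w & D p.2 w p.1); first by exists w.
  by exists k.
have [wit {}wP] := choice wP.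
pose P : set (O * O) := [set p | exists2 w, H w & D p.2 w p.1].
have [||z Hz zP] := Hdir (wit @` ((x `*` seg theta) `&` P)).
- by move=> _ [p [_ Pp] <-]; have [] := wP _ Pp.
- apply/small_image/(@small_le _ _ _ _ (x `*` seg theta)).
    by apply: subset_card_le => p [].
  by apply: small_setX => //; exact: small_seg.
exists z => // w j Hw zw kj jt.
have sub u v : H u -> H v -> (u < v)%O -> D j u `<=` D j v.
  move=> Hu Hv uv; apply: Dtr => //; first exact: Hl.
  exact: matrix_mono (Hl _ Hv) kj jt _ (Hchain _ _ Hu Hv uv).
apply/seteqP; split=> a [Da xa]; split=> //; last exact: sub Hz Hw zw _ Da.
have Pa : P (a, j) by exists w.
have [Hwit Dwit] := wP _ Pa.
apply: sub (Hwit) Hz _ _ Dwit; apply: zP.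
by exists (a, j).
Qed.

(** * Long chains and coherence of traces *)

Section Guessing.
Context (kappa k1 r : O).
Hypotheses (kreg : regular kappa) (k1reg : regular k1) (rreg : regular r) (lreg : regular l).
Hypotheses (tk : (theta < kappa)%O) (kk1 : (kappa < k1)%O) (k1r : (k1 < r)%O) (rl : (r < l)%O).
Hypothesis Dun : uniform_matrix theta l D.

(* The sequence [f] anticipates every initial segment of every guess: as soon as
   such a segment can be covered by one [D i b], some such [b] occurs before the
   next value of [f].  A guess inside the club given by uniformity at [f r] has
   all its segments covered, and pigeonhole makes the index constant. *)
Lemma ex_long_chain (s : O -> O) : (forall a, (a < l)%O -> (s a < l)%O) ->
  exists k (H : set O), [/\ (k < theta)%O, H `<=` seg l,
    forall z w, H z -> H w -> (z < w)%O -> D k w z /\ (s z < w)%O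
  & forall Y, Y `<=` H -> small kappa Y -> exists2 w, H w & forall z, Y z -> (z < w)%O].
Proof.
move=> sl; have [c cP] := club_guessing kreg k1reg rreg kk1 k1r.
have kr := lt_trans kk1 k1r.
(* The answer to [Y] is a column covering [Y] at some index, if there is one. It depends on [Y]
   alone, so it can be computed before the sequence is complete. *)
have ansP (Y : set O) : exists b, (b < l)%O /\
    ((exists b i, [/\ (b < l)%O, (i < theta)%O & Y `<=` D i b]) ->
     exists2 i, (i < theta)%O & Y `<=` D i b).
  have [[b [i [bl it Yi]]]|nE] := pselect (exists b i, [/\ (b < l)%O, (i < theta)%O & Y `<=` D i b]).
    by exists b; split=> // _; exists i.
  by exists r.
have [ans {}ansP] := choice ansP.
pose cut a (G : set (O * O)) : set O := [set z | exists2 x, c a x & G (x, z)].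
(* The next value must exceed [s] at the current one and the answers for all [r] guesses, each cut
   off at the current stage. There are fewer than [l] demands, as [r < l]. *)
pose W x (G : set (O * O)) : set O := [set u | (exists2 z, G (x, z) & u = s z) \/
  exists2 a, (a < r)%O & u = ans (cut a G)].
have [f a ar fl|f [fl finc fcont fW]] := @ex_continuous_sequence r l W lreg rl.
  have [|u ul uP] := regular_bound (f := fun b => ans (cut b (graph_upto f a)))
      lreg (regular_small_seg lreg rl).
    by move=> b _; have [] := ansP (cut b (graph_upto f a)).
  have [v sv vl] := regular_lt lreg (sl _ (fl _ (lexx a))).
  exists (Order.max u v); first by rewrite gt_max ul vl.
  by move=> _ [[z [_ /= ->] ->]|[b br ->]]; rewrite lt_max ?sv ?orbT // uP.
have rlim := regular_is_limit rreg.
have [i0 i0t [C Cclub CD]] := Dun (continuous_limit finc fcont rlim (lexx _)) (fl _ (lexx _)).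
have [a [ar acof [ca cunb] cE]] := cP _ (club_preimage kreg rreg kr finc fcont Cclub).
have cr x : c a x -> (x < r)%O by move=> /ca/lt_trans; apply.
(* The points of the guess [c a] at which the single index [k] captures all earlier points of the
   guess. *)
pose P k x := c a x /\ forall z, c a z -> (z < x)%O -> D k (f x) (f z).
have PP x : (x < a)%O -> exists x' k, [/\ (x <= x')%O, (k < theta)%O & P k x'].
  move=> xa; have [y cy xy] := cunb _ xa.
  have [_ kinf _] := kreg.
  have [y' yy' y'a] := has_cofinality_lt kinf acof (ca _ cy).
  have [y'' cy'' y'y''] := cunb _ y'a.
  (* [n] is the successor of [y] within [c a], so the guess below [n] equals the guess up to [y],
     which was answered at stage [y]. *)
  have [|n [cn yn] nmin] := @ex_least [set n | c a n /\ (y < n)%O].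
    by exists y''; split=> //; exact: lt_le_trans y'y''.
  have [bl []] := ansP (cut a (graph_upto f y)).
    exists (f r), i0; split=> //; first exact: fl.
    by move=> z [w cw [_ /= ->]]; apply: CD; have [] := cE _ cw.
  set b := ans _ in bl * => i it iP.
  have nr := ltW (cr _ cn).
  have bn : (b < f n)%O by apply: fW yn nr _; right; exists a.
  have [j jt Dj] := matrix_ex bn (fl _ nr).
  exists n, (Order.max i j); split; first exact: le_trans xy (ltW yn).
    by rewrite gt_max it jt.
  split=> // z cz zn.
  have zy : (z <= y)%O.
    by rewrite leNgt; apply/negP => yz; have := nmin z (conj cz yz); rewrite leNgt zn.
  have mt : (Order.max i j < theta)%O by rewrite gt_max it jt.
  have mj : (j <= Order.max i j)%O by rewrite le_max lexx orbT.
  have mi : (i <= Order.max i j)%O by rewrite le_max lexx.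
  (* The answer [b] belongs to the column of [f n] at this index, so by transitivity that column
     contains everything [b] covers. *)
  apply: (Dtr bn (fl _ nr) mt (matrix_mono (fl _ nr) mj mt Dj)).
  apply: matrix_mono bl mi mt _ _; apply: iP.
  by exists z.
(* Pigeonhole: if every [P k] were bounded in [a], the [theta < kappa] bounds would have a common
   bound below [a], contradicting [PP]. *)
have [k kt Punb] : exists2 k, (k < theta)%O & unbounded_in a (P k).
  apply: contrapT => H.
  have bP k : exists b, (k < theta)%O -> (b < a)%O /\ forall x, P k x -> (x < b)%O.
    have [kt|nE] := pselect (k < theta)%O; last by exists k.
    have [||b] := @unboundedPn a (P k); [by move=> x [/ca]| |by exists b].
    by move=> ?; apply: H; exists k.
  have [b {}bP] := choice bP.
  have [_ /(_ (b @` seg theta))[]] := acof.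
  - by move=> _ [k kt <-]; have [] := bP k kt.
  - by apply: small_image; exact: regular_small_seg.
  move=> u ua uP; have [x [k [ux kt Pk]]] := PP _ ua.
  have [_ /(_ _ Pk) xb] := bP _ kt.
  have := le_lt_trans ux xb; rewrite ltNge => /negP; apply.
  by apply/ltW/uP; exists k.
exists k, (f @` P k); split=> //.
- by move=> _ [x [cx _] <-]; apply: fl; exact: ltW (cr _ cx).
- move=> _ _ [z Pz <-] [w Pw <-] fzw.
  have zw : (z < w)%O.
    rewrite ltNge le_eqVlt; apply/negP => /orP[/eqP wz|wz].
      by move: fzw; rewrite wz ltxx.
    have := finc _ _ wz (ltW (cr _ (proj1 Pz))); by rewrite ltNge (ltW fzw).
  split; first by case: Pw => _; apply=> //; case: Pz.
  apply: fW zw (ltW (cr _ (proj1 Pw))) _; left.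
  by exists (f z).
- move=> Y YH Ys.
  have iP y : exists x, Y y -> P k x /\ f x = y.
    have [/YH[x Px fx]|nE] := pselect (Y y); last by exists k.
    by exists x.
  have [i {}iP] := choice iP.
  have [_ /(_ (i @` Y))[]] := acof.
  + by move=> _ [y Yy <-]; have [[/ca]] := iP _ Yy.
  + exact: small_image.
  move=> b ba bP; have [_ /(_ b ba)[x Px bx]] := Punb.
  exists (f x); first by exists x.
  move=> y Yy; have [_ <-] := iP _ Yy; apply: finc; last exact: ltW (cr _ (proj1 Px)).
  by apply: lt_le_trans bx; apply: bP; exists y.
Qed.

(** Otherwise [s] maps each [g] to some [b] whose traces on [x] differ from those of [g] at
    cofinally many indices. On a chain jumping over [s], take a stable [z] and a later [w]: at large
    indices the trace at [s z] lies between those at [z] and [w], which are equal. *)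
Lemma local_coherence (x : set O) : small kappa x ->
  exists2 g, (g < l)%O & forall b, (g <= b)%O -> (b < l)%O ->
    exists2 i, (i < theta)%O & forall j, (i <= j)%O -> (j < theta)%O ->
      D j b `&` x = D j g `&` x.
Proof.
move=> xs; apply: contrapT => Hn.
have sP g : exists b, (g < l)%O -> [/\ (b < l)%O, (g <= b)%O & forall i, (i < theta)%O ->
    exists j, [/\ (i <= j)%O, (j < theta)%O & D j b `&` x <> D j g `&` x]].
  have [gl|nE] := pselect (g < l)%O; last by exists g.
  apply: contrapT => H; apply: Hn; exists g => // b gb bl.
  apply: contrapT => H'; apply: H; exists b => _; split=> // i it.
  apply: contrapT => H; apply: H'; exists i => // j ij jt.
  by apply: contrapT => E; apply: H; exists j.
have [s {}sP] := choice sP.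
have [|k [H [kt Hl Hchain Hdir]]] := @ex_long_chain s; first by move=> g /sP[].
have [z w Hz Hw|z Hz zP] := chain_stable kreg tk xs Hl kt _ Hdir.
  by move=> /(Hchain _ _ Hz Hw)[].
have [_ kinf _] := kreg.
have [||w Hw zw] := Hdir [set z]; first by move=> _ ->.
  by apply: small_finite => //; exact: finite_set1.
have {}zw : (z < w)%O by exact: zw.
have [_ szw] := Hchain _ _ Hz Hw zw.
have [bl zb bP] := sP _ (Hl _ Hz).
have t0 : exists i, (i < theta)%O by exists k.
have [i it iP] := matrix_eventually_sub zb bl t0.
have [j jt jP] := matrix_eventually_sub (ltW szw) (Hl _ Hw) t0.
have [|m [mP mt]] := bP (Order.max k (Order.max i j)); first by rewrite !gt_max kt it jt.
move: mP; rewrite !ge_max => /and3P[km im jm]; apply.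
apply/seteqP; split=> a [Da xa]; split=> //; last exact: iP Da.
have : (D m w `&` x) a by split=> //; exact: jP Da.
by rewrite (zP _ _ Hw zw km mt) => -[].
Qed.

End Guessing.
End CoveringMatrix.
End Ordinals.

(** * The narrow system of traces and its branch *)

Theorem theorem2p9 (d : Order.disp_t) (O : orderType d) (wfO : well_ordered O)
    (mu mu1 theta theta1 theta2 : O)
    (mu_sing : singular_cardinal mu)
    (mu1E : is_succ_cardinal mu mu1)
    (thetaE : is_cofinality mu theta)
    (theta1E : is_succ_cardinal theta theta1)
    (theta2E : is_succ_cardinal theta1 theta2)
    (hkappa : exists kappa : O,
       [/\ regular_cardinal kappa, (theta2 <= kappa)%O, (kappa < mu)%O
         & cNSP kappa mu1])
    (D : O -> O -> set O) :
  covering_matrix theta mu1 D -> uniform_matrix theta mu1 D ->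
  transitive_matrix theta mu1 D ->
  CP theta mu1 D.
Proof.
move=> Dcov Dun Dtr; have [kappa [/(regular_cardinal_regular wfO) kreg t2k kmu nsp]] := hkappa.
have [kc kinf _] := kreg; have [[muc muinf] musing] := mu_sing.
have [t1c tt1 t1min] := theta1E; have [t2c t1t2 _] := theta2E.
have t1k := lt_le_trans t1t2 t2k; have tk := lt_trans tt1 t1k.
have mul1 : (mu < mu1)%O by have [] := mu1E.
have lreg : regular mu1 by exact: (regular_succ wfO muinf mu1E).
have [k1 k1E k1mu] := ex_succ_cardinal wfO muc kmu.
have k1reg : regular k1 by exact: (regular_succ wfO kinf k1E).
have [_ k1inf _] := k1reg; have [_ kk1 _] := k1E.
(* The successor of [kappa] is regular, so it differs from the singular [mu]; hence its own
   successor [r] is at most [mu], and so below [mu1]. *)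
have {}k1mu : (k1 < mu)%O.
  rewrite lt_neqAle k1mu andbT; apply/eqP => E; apply: musing; rewrite -E.
  exact: regular_cofinality.
have [r rE rmu] := ex_succ_cardinal wfO muc k1mu.
have rreg : regular r by exact: (regular_succ wfO k1inf rE).
have [_ k1r _] := rE; have rl := le_lt_trans rmu mul1.
have coh := local_coherence wfO Dcov Dtr kreg k1reg rreg lreg tk kk1 k1r rl Dun.
have kl := lt_trans kmu mul1.
pose A : set (set O) := [set x | Pkl kappa mu1 x /\ exists2 m, x m & forall z, x z -> (z <= m)%O].
(* The pair consists of the maximum of [x] and a coherence point for [x] raised above that maximum;
   the raised point stays coherent, by comparison with the original one. *)
have mgP (x : set O) : exists p : O * O, A x -> [/\ x p.1, forall z, x z -> (z <= p.1)%O,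
    (p.1 < p.2)%O, (p.2 < mu1)%O & forall b, (p.2 <= b)%O -> (b < mu1)%O ->
    exists2 i, (i < theta)%O & forall j, (i <= j)%O -> (j < theta)%O ->
      D j b `&` x = D j p.2 `&` x].
  have [[[xl xs] [m xm mP]]|nE] := pselect (A x); last by exists (mu, mu).
  have [g gl gP] := coh x (proj1 (smallE wfO kappa x) xs).
  have [m' mm' m'l] := regular_lt lreg (xl _ xm).
  have hl : (Order.max g m' < mu1)%O by rewrite gt_max gl m'l.
  exists (m, Order.max g m') => _; split=> //=; first by rewrite lt_max mm' orbT.
  move=> b; rewrite ge_max => /andP[gb m'b] bl.
  have [i it iP] := gP _ gb bl.
  have [|i' it' iP'] := gP _ _ hl; first by rewrite le_max lexx.
  exists (Order.max i i'); first by rewrite gt_max it it'.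
  by move=> j; rewrite ge_max => /andP[ij i'j] jt; rewrite iP // iP'.
have [mg {}mgP] := choice mgP.
pose S (x : set O) : set (set O) := [set t | exists2 i, (i < theta)%O &
  D i (mg x).2 (mg x).1 /\ t = D i (mg x).2 `&` x].
have Acof : cofinal_in_Pkl kappa mu1 A.
  split; first by move=> x [].
  move=> x [xl /(smallE wfO) xs].
  have xs' : small mu1 x.
    have [t tk' xt] := seg_le_or_lt wfO xs.
    exact: small_le xt (regular_small_seg lreg (lt_trans tk' kl)).
  have [|m ml mP] := regular_bound (f := id) lreg xs'; first exact: xl.
  exists (x `|` [set m]); last by move=> z; left.
  split; last by exists m; [right|move=> z [/mP/ltW|->]].
  split; first by move=> z [/xl|->].
  apply/(smallE wfO).
  have [xfin|xinf] := pselect (finite_set x); last exact: small_le (card_le_setU1 m xinf) xs.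
  by apply: small_finite => //; rewrite finite_setU; split=> //; exact: finite_set1.
have sysP : concrete_system kappa mu1 A S.
  split=> // [x Ax|x y Ax Ay xy].
    have [xm mmax mg1 gl gP] := mgP _ Ax.
    split; last by move=> _ [i it [_ ->]] z [].
    have [i it Di] := matrix_ex Dcov mg1 gl.
    by exists (D i (mg x).2 `&` x), i.
  have [xm mmax mg1 gl gP] := mgP _ Ax.
  have [ym nmax ng1 hl hP] := mgP _ Ay.
  pose b := Order.max (mg x).2 (mg y).2.
  have bl : (b < mu1)%O by rewrite gt_max gl hl.
  have [|//|i1 it1 iP1] := gP b; first by rewrite le_max lexx.
  have [|//|i2 it2 iP2] := hP b; first by rewrite le_max lexx orbT.
  have [i3 it3 Di3] := matrix_ex Dcov mg1 gl.
  have [i4 it4 Di4] := matrix_ex Dcov ng1 hl.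
  (* [i1] and [i2] make both traces agree with that of the common column [b]; [i3] and [i4] put the
     two maxima into their traces. *)
  pose j := Order.max (Order.max i1 i2) (Order.max i3 i4).
  have jt : (j < theta)%O by rewrite !gt_max it1 it2 it3 it4.
  have [j1 j2 j3 j4] : [/\ (i1 <= j)%O, (i2 <= j)%O, (i3 <= j)%O & (i4 <= j)%O].
    by rewrite /j !le_max !lexx !orbT.
  exists (D j (mg y).2 `&` y).
    by exists j => //; split=> //; exact: (matrix_mono Dcov hl j4).
  exists j => //; split; first exact: (matrix_mono Dcov gl j3).
  by rewrite -(iP1 j j1 jt) -(iP2 j j2 jt) -setIA (setIidr xy).
have Sle x : S x #<= seg theta.
  apply: (@card_le_surj _ _ _ _ (fun i => D i (mg x).2 `&` x)) => t [i it [_ ->]].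
  by exists i.
have nar : narrow_system kappa A S.
  (* The least ordinal bounding all levels is automatically a cardinal. It is at most [theta], so
     its successor cardinal is at most [theta1 < kappa]. *)
  have [|w wP wmin] := @ex_least _ _ wfO [set w | forall x, A x -> S x #<= seg w].
    by exists theta => x _; exact: Sle.
  have wt : (w <= theta)%O by apply: wmin => x _; exact: Sle.
  have wt1 := le_lt_trans wt tt1.
  have [w' w'E w't1] := ex_succ_cardinal wfO t1c wt1.
  exists w, w'; split=> //; last exact: le_lt_trans t1k.
  split=> // [a aw /card_eqPle[_ wa]|w2 _ w2P]; last exact: wmin.
  suff : (w <= a)%O by rewrite leNgt aw.
  by apply: wmin => x /wP/card_le_trans; apply.
have [b [bl [_ bcof]]] := nsp A S sysP nar.
exists b.
  split=> // g gl.
  (* The maximum of such an [x] lies in the chosen trace, hence in [b], and is at least [g]. *)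
  have [|x [Ax [i it [Di bx]]] gx] := bcof [set g].
    split; first by move=> _ ->.
    by apply/(smallE wfO)/small_finite => //; exact: finite_set1.
  have [xm mmax _ _ _] := mgP _ Ax.
  exists (mg x).1; last by apply: mmax; exact: gx.
  by have : (D i (mg x).2 `&` x) (mg x).1 by []; rewrite -bx => -[].
move=> X Xb Xt.
(* As [theta < kappa], the branch reaches some [x] containing [X], where it agrees with a single
   entry of the matrix. *)
have [|x [Ax [i it [Di bx]]] Xx] := bcof X.
  split; first exact: subset_trans bl.
  apply/(smallE wfO); move: Xt => /card_eqPle[Xt _].
  exact: small_le Xt (regular_small_seg kreg tk).
exists (mg x).2, i; split=> //; first by have [] := mgP _ Ax.
move=> z Xz; have : (b `&` x) z by split; [exact: Xb|exact: Xx].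
by rewrite bx => -[].
Qed.
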